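(* Let $T$ be the theory of the Fraïssé limit of the class $\mathbb{K}$ of finite meet-trees expanded by a graph relation. Then $T$ is NTP$_2$ and is, in fact, inp-minimal.
   Context: The language $L$ consists of two binary relations $R, \unlhd$ and a binary function $\wedge$. $\mathbb{K}$ is the class of finite $L$-structures $(A,\unlhd^A,\wedge^A,R^A)$ such that $(A,\unlhd^A,\wedge^A)$ is a meet-tree ($\unlhd^A$ is a partial order in which the set of elements below any given element is linearly ordered, and any two elements $a,b$ have a greatest lower bound $a \wedge^A b$), and $R^A$ is a graph (symmetric irreflexive relation) on $A$, with no required interaction between $R$ and the tree structure. $\mathbb{K}$ is a Fraïssé class. A formula $\varphi(x;y)$ has TP$_2$ if there are an array of tuples $(a_{i,j})_{i,j<\omega}$ and $k<\omega$ such that: (1) for all $f:\omega\to\omega$, $\{\varphi(x;a_{i,f(i)}) : i<\omega\}$ is consistent; (2) for all $i<\omega$, $\{\varphi(x;a_{i,j}) : j<\omega\}$ is $k$-inconsistent (every subset of size $k$ is inconsistent). A theory is NTP$_2$ if no formula has TP$_2$ modulo it. A theory is inp-minimal if there is no inp-pattern of depth $2$ in a single variable: that is, there are no formulas $\varphi_0(x;y_0),\varphi_1(x;y_1)$ with $x$ a single variable, tuples $(a_{i,j})_{i<2,j<\omega}$ and $k_0,k_1<\omega$ such that $\{\varphi_i(x;a_{i,j}) : j<\omega\}$ is $k_i$-inconsistent for each $i<2$ and $\{\varphi_0(x;a_{0,f(0)}),\varphi_1(x;a_{1,f(1)})\}$ is consistent for every $f:\{0,1\}\to\omega$. *)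

(* Defs.v *)
From mathcomp Require Import all_boot.
From mathcomp Require Import boolp classical_sets cardinality.

Set Implicit Arguments.
Unset Strict Implicit.
Unset Printing Implicit Defensive.

Local Open Scope classical_set_scope.

(** * Structures in the language L = {R, <|, /\} *)

Record structure := Structure {
  carrier :> Type;
  le : carrier -> carrier -> Prop;
  meet : carrier -> carrier -> carrier;
  adj : carrier -> carrier -> Prop
}.
Arguments le {s}.
Arguments meet {s}.
Arguments adj {s}.

Definition embedding (A B : structure) (f : A -> B) : Prop :=
  [/\ injective f,
      forall a b, le (f a) (f b) <-> le a b,
      forall a b, f (meet a b) = meet (f a) (f b) &
      forall a b, adj (f a) (f b) <-> adj a b].

Definition isomorphism (A B : structure) (f : A -> B) : Prop :=
  embedding f /\ bijective f.

Definition isomorphic (A B : structure) : Prop :=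
  exists f : A -> B, isomorphism f.

Record substructure (M : structure) := Substructure {
  support :> set M;
  support_meet : forall a b, support a -> support b -> support (meet a b)
}.

Definition induced (M : structure) (A : substructure M) : structure :=
  {| carrier := {x : M | support A x};
     le a b := le (sval a) (sval b);
     meet a b := exist _ (meet (sval a) (sval b))
                   (support_meet (svalP a) (svalP b));
     adj a b := adj (sval a) (sval b) |}.

Definition finitely_generated (M : structure) (A : substructure M) : Prop :=
  exists X : set M, [/\ finite_set X, X `<=` A &
    forall B : substructure M, X `<=` B -> A `<=` B].

(** * The class K and Fraisse limits *)

Definition is_meet_tree (A : structure) : Prop :=
  [/\ forall a : A, le a a,
      forall a b : A, le a b -> le b a -> a = b,
      forall a b c : A, le a b -> le b c -> le a c,
      forall a b c : A, le b a -> le c a -> le b c \/ le c b &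
      forall a b : A, [/\ le (meet a b) a, le (meet a b) b &
        forall c : A, le c a -> le c b -> le c (meet a b)]].

Definition is_graph (A : structure) : Prop :=
  (forall a b : A, adj a b -> adj b a) /\ (forall a : A, ~ adj a a).

(* The empty structure is allowed, so that it may also appear in an age. *)
Definition class_K (A : structure) : Prop :=
  [/\ finite_set [set: A], is_meet_tree A & is_graph A].

Definition age (M A : structure) : Prop :=
  exists B : substructure M, finitely_generated B /\ isomorphic (induced B) A.

Definition ultrahomogeneous (M : structure) : Prop :=
  forall (A B : substructure M) (f : induced A -> induced B),
    finitely_generated A -> finitely_generated B -> isomorphism f ->
    exists h : M -> M,
      isomorphism h /\ forall a : induced A, h (sval a) = sval (f a).

Definition is_fraisse_limit (K : structure -> Prop) (M : structure) : Prop :=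
  [/\ countable [set: M], forall A, age M A <-> K A & ultrahomogeneous M].

(** * First-order formulas and theories *)

Inductive term (n : nat) : Type :=
| TVar of 'I_n
| TMeet of term n & term n.

(* [formula n] has its free variables among 0, ..., n - 1; the quantifier binds
   variable 0 of its body and shifts the others.  The remaining connectives
   are classically definable. *)
Inductive formula : nat -> Type :=
| FEq n of term n & term n : formula n
| FLe n of term n & term n : formula n
| FAdj n of term n & term n : formula n
| FFalse n : formula n
| FImp n of formula n & formula n : formula n
| FAll n of formula n.+1 : formula n.

Fixpoint eval (M : structure) n (t : term n) (v : n.-tuple M) : M :=
  match t with
  | TVar i => tnth v i
  | TMeet t1 t2 => meet (eval t1 v) (eval t2 v)
  end.

Fixpoint sat (M : structure) n (phi : formula n) : n.-tuple M -> Prop :=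
  match phi in formula n return n.-tuple M -> Prop with
  | FEq _ t1 t2 => fun v => eval t1 v = eval t2 v
  | FLe _ t1 t2 => fun v => le (eval t1 v) (eval t2 v)
  | FAdj _ t1 t2 => fun v => adj (eval t1 v) (eval t2 v)
  | FFalse _ => fun=> False
  | FImp _ p q => fun v => sat p v -> sat q v
  | FAll _ p => fun v => forall x : M, sat p (cons_tuple x v)
  end.

Definition theory := set (formula 0).

Definition theory_of (M : structure) : theory :=
  [set s | sat s ([tuple] : 0.-tuple M)].

Definition models (N : structure) (T : theory) : Prop := T `<=` theory_of N.

Definition elementary (N N' : structure) (g : N -> N') : Prop :=
  forall n (phi : formula n) (v : n.-tuple N),
    sat phi (map_tuple g v) <-> sat phi v.

(** * Consistency, TP2 and inp-patterns *)

(* An instance phi(x; a): x is the n-tuple of the first n variables of phi and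
   the parameters a are substituted for the remaining ones. *)
Record instance (N : structure) (n : nat) := Instance {
  arity : nat;
  body : formula (n + arity);
  params : arity.-tuple N
}.
Arguments Instance {N n arity}.

(* Consistency with the elementary diagram of N.  It does not change when N is
   replaced by an elementary extension, so patterns may be sought in arbitrary
   models of the theory instead of a monster model. *)
Definition consistent (N : structure) n (p : set (instance N n)) : Prop :=
  exists (N' : structure) (g : N -> N'), elementary g /\
  exists b : n.-tuple N', forall q, p q ->
    sat (body q) (cat_tuple b (map_tuple g (params q))).

(* Subsets of size k of a family indexed by nat are sets of k indices, since
   otherwise constant families would be 2-inconsistent. *)
Definition k_inconsistent (N : structure) n (k : nat)
    (F : nat -> instance N n) : Prop :=
  forall J : seq nat, uniq J -> size J = k -> ~ consistent (F @` [set` J]).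

Definition has_TP2 (T : theory) n m (phi : formula (n + m)) : Prop :=
  exists N : structure, models N T /\
  exists (a : nat -> nat -> m.-tuple N) (k : nat),
    (forall f : nat -> nat,
       consistent [set Instance phi (a i (f i)) | i in [set: nat]]) /\
    (forall i : nat, k_inconsistent k (fun j => Instance phi (a i j))).

Definition NTP2 (T : theory) : Prop :=
  forall n m (phi : formula (n + m)), ~ has_TP2 T phi.

(* Inp-patterns of depth d in a single variable x. *)
Definition has_inp_pattern (T : theory) (d : nat) : Prop :=
  exists N : structure, models N T /\
  exists (m : 'I_d -> nat) (phi : forall i, formula (1 + m i))
         (a : forall i, nat -> (m i).-tuple N) (k : 'I_d -> nat),
    (forall i, k_inconsistent (k i) (fun j => Instance (phi i) (a i j))) /\
    (forall f : 'I_d -> nat,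
       consistent [set Instance (phi i) (a i (f i)) | i in [set: 'I_d]]).

Definition inp_minimal (T : theory) : Prop := ~ has_inp_pattern T 2.

(* Main.v *)
(* The proof is a direct count, without indiscernible sequences.  Suppose that
   there is an inp-pattern with n + 1 rows in n variables.  Its restriction to L
   columns is a first-order property, so it can be found in M.  It has L^(n+1)
   paths, each realized by an n-tuple.  The tree generated by the parameters has
   O(L) points, and adding one point to a meet-tree with K points can be done in
   only O(K) ways up to isomorphism, so there are O(L^n) positions of an n-tuple
   over it.  For large L, many paths hence share a position, and these paths use
   many different columns of some row i.  Let b_j be the corresponding tuple
   that realizes the formula at column j of row i.  After thinning out, the graph
   relations between b_j and the (boundedly many) points generated by b_j and
   the j-th parameter are pairwise compatible, and since the graph is independent
   of the tree they are realized simultaneously by one tuple in the common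
   position.  By homogeneity this tuple satisfies many formulas of row i,
   against k-inconsistency.  The case of n variables gives NTP2 and the case
   n = 1 gives inp-minimality. *)
From mathcomp Require Import all_boot zify.
From mathcomp Require Import boolp classical_sets cardinality.
Require Import Defs.

Set Implicit Arguments.
Unset Strict Implicit.
Unset Printing Implicit Defensive.

(** * Definability *)

Fixpoint trename n n' (r : 'I_n -> 'I_n') (t : term n) : term n' :=
  match t with
  | TVar i => TVar (r i)
  | TMeet t1 t2 => TMeet (trename r t1) (trename r t2)
  end.

Definition rlift n n' (r : 'I_n -> 'I_n') (i : 'I_n.+1) : 'I_n'.+1 :=
  if unlift ord0 i is Some j then lift ord0 (r j) else ord0.

Fixpoint rename n (phi : formula n) :
    forall n', ('I_n -> 'I_n') -> formula n' :=
  match phi in formula n return forall n', ('I_n -> 'I_n') -> formula n' with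
  | FEq _ t1 t2 => fun _ r => FEq (trename r t1) (trename r t2)
  | FLe _ t1 t2 => fun _ r => FLe (trename r t1) (trename r t2)
  | FAdj _ t1 t2 => fun _ r => FAdj (trename r t1) (trename r t2)
  | FFalse _ => fun n' _ => FFalse n'
  | FImp _ p q => fun _ r => FImp (rename p r) (rename q r)
  | FAll _ p => fun _ r => FAll (rename p (rlift r))
  end.

Lemma eval_trename (N : structure) n n' (r : 'I_n -> 'I_n') t (v : n'.-tuple N) :
  eval (trename r t) v = eval t [tuple tnth v (r i) | i < n].
Proof. by elim: t => [i|t1 IH1 t2 IH2] /=; rewrite ?tnth_mktuple ?IH1 ?IH2. Qed.

Lemma sat_rename (N : structure) n (phi : formula n) :
  forall n' (r : 'I_n -> 'I_n') (v : n'.-tuple N),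
    sat (rename phi r) v <-> sat phi [tuple tnth v (r i) | i < n].
Proof.
elim: phi => {n} [n t1 t2|n t1 t2|n t1 t2|n|n p IHp q IHq|n p IHp] n' r v /=;
  rewrite ?eval_trename //.
  by rewrite (IHp n' r v) (IHq n' r v).
have E x : [tuple tnth (cons_tuple x v) (rlift r i) | i < n.+1]
           = cons_tuple x [tuple tnth v (r i) | i < n].
  apply: eq_from_tnth => i; rewrite tnth_mktuple /rlift.
  case: unliftP => [j ->|->]; last by rewrite !tnth0.
  by rewrite !tnthS tnth_mktuple.
by split=> H x; move: (H x); rewrite IHp E.
Qed.

Definition vec n (T : Type) (e : nat -> T) : n.-tuple T := [tuple e i | i < n].

Definition scons (T : Type) (x : T) (e : nat -> T) (i : nat) : T :=
  if i is j.+1 then e j else x.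

Lemma vec_scons n (T : Type) (x : T) (e : nat -> T) :
  vec n.+1 (scons x e) = cons_tuple x (vec n e).
Proof.
apply: eq_from_tnth => i; rewrite tnth_mktuple.
case: (unliftP ord0 i) => [j ->|->]; last by rewrite tnth0.
by rewrite tnthS tnth_mktuple.
Qed.

Lemma vec_nth n (T : Type) (x0 : T) (v : n.-tuple T) : vec n (nth x0 v) = v.
Proof. by apply: eq_from_tnth => i; rewrite tnth_mktuple -tnth_nth. Qed.

Lemma map_vec n (T T' : Type) (g : T -> T') (e : nat -> T) :
  map_tuple g (vec n e) = vec n (g \o e).
Proof. by apply: eq_from_tnth => i; rewrite tnth_map !tnth_mktuple. Qed.

(** Environments indexed by all of [nat] let properties with different numbers of free variables
    combine without arity bookkeeping. One formula has to serve all structures, as transfer between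
    models requires. *)
Definition definable (P : forall N : structure, (nat -> N) -> Prop) : Prop :=
  exists n (phi : formula n),
    forall (N : structure) (e : nat -> N), sat phi (vec n e) <-> P N e.

Lemma definable_ext (P Q : forall N : structure, (nat -> N) -> Prop) :
  (forall N e, P N e <-> Q N e) -> definable P -> definable Q.
Proof.
by move=> PQ [n [phi H]]; exists n, phi => N e; rewrite H.
Qed.

Lemma definable_rename n (phi : formula n) (r : nat -> nat) :
  exists n0, forall n', n0 <= n' -> exists phi' : formula n',
    forall (N : structure) (e : nat -> N),
      sat phi' (vec n' e) <-> sat phi (vec n (e \o r)).
Proof.
exists (\max_(i < n) (r i).+1) => n' len'.
have rlt (i : 'I_n) : r i < n'.
  by apply: leq_trans len'; apply: (leq_bigmax i).
exists (rename phi (fun i => Ordinal (rlt i))) => N e; rewrite sat_rename.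
suff -> : [tuple tnth (vec n' e) (Ordinal (rlt i)) | i < n] = vec n (e \o r) by [].
by apply: eq_from_tnth => i; rewrite !tnth_mktuple.
Qed.

Lemma definable_widen P :
  definable P -> exists n0, forall n', n0 <= n' -> exists phi : formula n',
    forall (N : structure) (e : nat -> N), sat phi (vec n' e) <-> P N e.
Proof.
move=> [n [phi H]]; have [n0 Hn0] := definable_rename phi id.
by exists n0 => n' /Hn0[phi' H']; exists phi' => N e; rewrite H'.
Qed.

Lemma definable_sat n (phi : formula n) (r : nat -> nat) :
  definable (fun N e => sat phi (vec n (e \o r))).
Proof.
have [n0 Hn0] := definable_rename phi r.
by have [phi' H] := Hn0 _ (leqnn n0); exists n0, phi'.
Qed.

Lemma definable_subst P (r : nat -> nat) :
  definable P -> definable (fun N e => P N (e \o r)).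
Proof.
move=> [n [phi H]]; apply: definable_ext (definable_sat phi r) => N e.
exact: H.
Qed.

Lemma definable_false : definable (fun _ _ => False).
Proof. by exists 0, (FFalse 0). Qed.

Lemma definable_imp P Q :
  definable P -> definable Q -> definable (fun N e => P N e -> Q N e).
Proof.
move=> /definable_widen[n1 H1] /definable_widen[n2 H2].
have [p Hp] := H1 _ (leq_maxl n1 n2).
have [q Hq] := H2 _ (leq_maxr n1 n2).
by exists (maxn n1 n2), (FImp p q) => N e /=; rewrite Hp Hq.
Qed.

Lemma definable_all P :
  definable P -> definable (fun N e => forall x, P N (scons x e)).
Proof.
move=> /definable_widen[n0 /(_ _ (leqnSn n0))[p Hp]].
exists n0, (FAll p) => N e /=.
by split=> H x; move: (H x); rewrite -vec_scons Hp.
Qed.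

Lemma definable_not P : definable P -> definable (fun N e => ~ P N e).
Proof. by move=> dP; apply: definable_imp dP definable_false. Qed.

Lemma definable_and P Q :
  definable P -> definable Q -> definable (fun N e => P N e /\ Q N e).
Proof.
move=> dP dQ.
apply: definable_ext (definable_not (definable_imp dP (definable_not dQ))) => N e.
split=> [H|[p q] /(_ p)] //.
by split; apply: contrapT => n; apply: H.
Qed.

Definition upd (T : Type) (e : nat -> T) (k : nat) (x : T) (i : nat) : T :=
  if i == k then x else e i.

Lemma definable_ex P k :
  definable P -> definable (fun N e => exists x, P N (upd e k x)).
Proof.
move=> dP.
(* [FAll] binds index 0, so index [k] is redirected to 0 and every other index is shifted up by
   one. *)
have := definable_not (definable_all (definable_not
  (definable_subst (fun i => if i == k then 0 else i.+1) dP))).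
apply: definable_ext => N e.
have E x : scons x e \o (fun i => if i == k then 0 else i.+1) = upd e k x.
  by apply: funext => i; rewrite /upd /=; case: eqP.
rewrite -existsNP; split=> -[x].
  by rewrite E => /contrapT; exists x.
by exists x; rewrite E.
Qed.

Definition splice (T : Type) n (b e : nat -> T) (i : nat) : T :=
  if i < n then b i else e i.

Lemma definable_exs P n :
  definable P -> definable (fun N e => exists b, P N (splice n b e)).
Proof.
elim: n P => [|n IHn] P dP.
  apply: definable_ext dP => N e.
  have E b : splice 0 b e = e by apply: funext.
  by split=> [H|[b]]; [exists e; rewrite E|rewrite E].
apply: definable_ext (IHn _ (definable_ex n dP)) => N e; split.
  move=> [b [x H]]; exists (upd b n x).
  suff -> : splice n.+1 (upd b n x) e = upd (splice n b e) n x by [].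
  apply: funext => i; rewrite /splice /upd ltnS (leq_eqVlt i n).
  by case: eqP.
move=> [b H]; exists b, (b n).
suff -> : upd (splice n b e) n (b n) = splice n.+1 b e by [].
apply: funext => i; rewrite /splice /upd ltnS (leq_eqVlt i n).
by case: eqP => [->|].
Qed.

Lemma definable_true : definable (fun _ _ => True).
Proof.
by apply: definable_ext (definable_imp definable_false definable_false).
Qed.

Lemma definable_forall_fin (I : finType)
    (P : I -> forall N : structure, (nat -> N) -> Prop) :
  (forall i, definable (P i)) -> definable (fun N e => forall i, P i N e).
Proof.
move=> dP.
suff [n [phi H]] : definable (fun N e => forall i, i \in enum I -> P i N e).
  exists n, phi => N e; rewrite H; split=> {}H i; last by move=> _; exact: H.
  by apply: H; rewrite mem_enum.
elim: (enum I) => [|i s IHs]; first exact: definable_ext definable_true.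
apply: definable_ext (definable_and (dP i) IHs) => N e; split.
  by move=> [Hi Hs] j; rewrite inE => /predU1P[->|/Hs].
move=> H; split=> [|j js]; apply: H; first exact: mem_head.
by rewrite inE js orbT.
Qed.

(** [C] depends on neither the structure nor the environment, so it is decided outside of the
    logic. *)
Lemma definable_guard (C : Prop) P :
  definable P -> definable (fun N e => C -> P N e).
Proof.
move=> dP; case: (pselect C) => [c|nc].
  by apply: definable_ext dP => N e; split=> // H; apply: H.
by apply: definable_ext definable_true => N e.
Qed.

(** * Transfer along elementary equivalence, elementary maps and isomorphisms *)

Fixpoint universal_closure n : formula n -> formula 0 :=
  match n with
  | 0 => fun p => p
  | n'.+1 => fun p => universal_closure (FAll p)
  end.

Lemma sat_universal_closure (N : structure) n (p : formula n) :
  sat (universal_closure p) ([tuple] : 0.-tuple N)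
  <-> forall v : n.-tuple N, sat p v.
Proof.
elim: n p => [|n IHn] p /=.
  by split=> [H v|/(_ [tuple])//]; rewrite tuple0.
rewrite IHn /=; split=> [H v|H v x]; last exact: H.
rewrite (_ : v = cons_tuple (thead v) (behead_tuple v)); first exact: H.
by apply: val_inj; rewrite {1}(tuple_eta v).
Qed.

(** If [P] had no solution in [M], the universal closure of its negation would belong to the theory
    of [M] and hence hold in [N]. *)
Lemma transfer (M N : structure) P :
  inhabited M -> models N (theory_of M) -> definable P ->
  (exists e : nat -> N, P N e) -> exists e : nat -> M, P M e.
Proof.
move=> [x0] NM [n [phi H]] [e Pe]; apply: contrapT => nP.
suff /NM /sat_universal_closure /(_ (vec n e)) : theory_of M
    (universal_closure (FImp phi (FFalse n))).
  by move=> /= Hn; apply: Hn; apply/H.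
apply/sat_universal_closure => v satv; apply: nP; exists (nth x0 v).
by rewrite -H vec_nth.
Qed.

Lemma elementary_definable (N N' : structure) (g : N -> N') P (e : nat -> N) :
  elementary g -> definable P -> P N' (g \o e) <-> P N e.
Proof. by move=> eg [n [phi H]]; rewrite -!H -map_vec eg. Qed.

Lemma elementary_id (N : structure) : elementary (fun x : N => x).
Proof.
move=> n phi v.
by rewrite (_ : map_tuple _ v = v) //; apply: eq_from_tnth => i; rewrite tnth_map.
Qed.

Lemma sat_isomorphism (M N : structure) (h : M -> N) n (phi : formula n) :
  isomorphism h -> forall v : n.-tuple M, sat phi (map_tuple h v) <-> sat phi v.
Proof.
move=> [[hinj hle hmeet hadj] [h' hK h'K]].
have hev k (t : term k) v : eval t (map_tuple h v) = h (eval t v).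
  by elim: t => [i|t1 IH1 t2 IH2] /=; rewrite ?tnth_map // IH1 IH2 hmeet.
elim: phi => {n} [n t1 t2|n t1 t2|n t1 t2|n|n p IHp q IHq|n p IHp] v /=;
  rewrite ?hev //.
- by split=> [/hinj|->].
- by rewrite IHp IHq.
have E x : cons_tuple (h x) (map_tuple h v) = map_tuple h (cons_tuple x v).
  by apply: val_inj.
split=> H x; first by apply/IHp; rewrite -E; apply: H.
by rewrite -(h'K x) E; apply/IHp.
Qed.

(** * Fraisse limits of meet-trees with a graph *)

Lemma isomorphic_refl (A : structure) : isomorphic A A.
Proof. by exists id; split; [split|exists id]. Qed.

Definition generated (M : structure) (X : set M) : substructure M.
Proof.
refine (@Substructure M (fun x => forall B : substructure M,
  subset X (support B) -> support B x) _).
by move=> a b Ha Hb B XB; apply: support_meet; [exact: Ha|exact: Hb].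
Defined.

Lemma generated_in_K (M : structure) (X : set M) :
  is_fraisse_limit class_K M -> finite_set X -> class_K (induced (generated X)).
Proof.
move=> [_ ageM _] finX; apply/ageM; exists (generated X).
split; last exact: isomorphic_refl.
exists X; split=> // [x Xx B|B XB x Hx]; [exact|exact: Hx].
Qed.

(** Each axiom concerns at most three elements, and these generate a substructure that belongs to
    [class_K]. *)
Lemma fraisse_tree_graph (M : structure) :
  is_fraisse_limit class_K M -> is_meet_tree M /\ is_graph M.
Proof.
move=> HM.
suff three (x y z : M) : exists B : substructure M,
    [/\ support B x, support B y, support B z & class_K (induced B)].
  split; first split.
  - move=> a; have [B [Ba _ _ [_ [H _ _ _ _] _]]] := three a a a.
    exact: (H (exist _ a Ba)).
  - move=> a b ab ba; have [B [Ba Bb _ [_ [_ H _ _ _] _]]] := three a b b.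
    exact: (congr1 sval (H (exist _ a Ba) (exist _ b Bb) ab ba)).
  - move=> a b c; have [B [Ba Bb Bc [_ [_ _ H _ _] _]]] := three a b c.
    exact: (H (exist _ a Ba) (exist _ b Bb) (exist _ c Bc)).
  - move=> a b c; have [B [Ba Bb Bc [_ [_ _ _ H _] _]]] := three a b c.
    exact: (H (exist _ a Ba) (exist _ b Bb) (exist _ c Bc)).
  - move=> a b; have [B [Ba Bb _ [_ [_ _ _ _ H] _]]] := three a b b.
    have [H1 H2 _] := H (exist _ a Ba) (exist _ b Bb).
    split=> // c; have [C [Ca Cb Cc [_ [_ _ _ _ H'] _]]] := three a b c.
    have [_ _ H3] := H' (exist _ a Ca) (exist _ b Cb).
    exact: (H3 (exist _ c Cc)).
  split=> a.
    move=> b; have [B [Ba Bb _ [_ _ [H _]]]] := three a b b.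
    exact: (H (exist _ a Ba) (exist _ b Bb)).
  have [B [Ba _ _ [_ _ [_ H]]]] := three a a a.
  exact: (H (exist _ a Ba)).
pose X := (fun u => [\/ u = x, u = y | u = z]) : set M.
have finX : finite_set X.
  pose f (i : 'I_3) := tnth [tuple x; y; z] i.
  apply: (@sub_finite_set _ _ (f @` setT)%classic).
    by move=> u [] ->; [exists (inord 0)|exists (inord 1)|exists (inord 2)];
      rewrite // /f (tnth_nth x) inordK.
  exact/finite_image/finite_finset.
exists (generated X); split; last exact: generated_in_K.
- by move=> B; apply; constructor 1.
- by move=> B; apply; constructor 2.
- by move=> B; apply; constructor 3.
Qed.

(** * Elementary properties of meet-trees *)

Section MeetTree.
Variables (M : structure) (treeM : is_meet_tree M).

Lemma le_meet (a b : M) : le a b <-> meet a b = a.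
Proof.
have [refl anti trans _ inf] := treeM; have [ma mb mg] := inf a b.
split=> [ab|<-//]; apply: anti => //; exact: mg (refl a) ab.
Qed.

Lemma meetxx (a : M) : meet a a = a.
Proof. by apply/le_meet; have [refl _ _ _ _] := treeM. Qed.

Lemma meetC (a b : M) : meet a b = meet b a.
Proof.
have [refl anti trans _ inf] := treeM.
have [? ? h1] := inf a b; have [? ? h2] := inf b a.
by apply: anti; [apply: h2|apply: h1].
Qed.

Lemma le_meetl (a b : M) : le (meet a b) a.
Proof. by have [_ _ _ _ inf] := treeM; have [] := inf a b. Qed.

Lemma le_meetr (a b : M) : le (meet a b) b.
Proof. by have [_ _ _ _ inf] := treeM; have [] := inf a b. Qed.

Lemma meet_glb (a b c : M) : le c a -> le c b -> le c (meet a b).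
Proof. by have [_ _ _ _ inf] := treeM; have [_ _] := inf a b; apply. Qed.

Lemma lexx (a : M) : le a a.
Proof. by have [refl _ _ _ _] := treeM. Qed.

Lemma le_trans (b a c : M) : le a b -> le b c -> le a c.
Proof. by have [_ _ trans _ _] := treeM; exact: trans. Qed.

Lemma le_anti (a b : M) : le a b -> le b a -> a = b.
Proof. by have [_ anti _ _ _] := treeM; exact: anti. Qed.

Lemma le_total (a b c : M) : le b a -> le c a -> le b c \/ le c b.
Proof. by have [_ _ _ tot _] := treeM; exact: tot. Qed.

Lemma meetA (a b c : M) : meet a (meet b c) = meet (meet a b) c.
Proof.
have lel := le_meetl; have ler := le_meetr; have tr := le_trans.
apply: le_anti; apply: meet_glb.
- by apply: meet_glb; [exact: lel|apply: tr (ler _ _) (lel _ _)].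
- by apply: tr (ler _ _) (ler _ _).
- by apply: tr (lel _ _) (lel _ _).
- by apply: meet_glb; [apply: tr (lel _ _) (ler _ _)|exact: ler].
Qed.

End MeetTree.

(** * Homogeneity for finite families, and freedom of the graph over the tree *)

Definition closed_family (M : structure) (I : Type) (d : I -> M) : Prop :=
  forall i j, exists k, meet (d i) (d j) = d k.

(** Meets alone determine the tree structure: [a = b] is [meet a a = b], and [le a b] is
    [meet a b = a]. *)
Definition similar (M : structure) (I : Type) (d d' : I -> M) : Prop :=
  forall i j k, meet (d i) (d j) = d k <-> meet (d' i) (d' j) = d' k.

Lemma similar_eq (M : structure) (I : Type) (d d' : I -> M) :
  is_meet_tree M -> similar d d' -> forall i j, d i = d j <-> d' i = d' j.
Proof. by move=> tM sim i j; have := sim i i j; rewrite !meetxx. Qed.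

Lemma homogeneity (M : structure) (I : finType) (d d' : I -> M) :
  is_fraisse_limit class_K M -> closed_family d -> similar d d' ->
  (forall i j, adj (d i) (d j) <-> adj (d' i) (d' j)) ->
  exists h : M -> M, isomorphism h /\ forall i, h (d i) = d' i.
Proof.
move=> HM cl sim dadj.
have [tM _] := fraisse_tree_graph HM; have [_ _ homM] := HM.
have deq := similar_eq tM sim.
have cl' : closed_family d'.
  by move=> i j; have [k Hk] := cl i j; exists k; apply/sim.
have clR (e : I -> M) : closed_family e ->
    forall x y, (exists i, e i = x) -> (exists i, e i = y) ->
    exists i, e i = meet x y.
  by move=> cle _ _ [i <-] [j <-]; have [k ->] := cle i j; exists k.
pose A := @Substructure M (fun x => exists i, d i = x) (clR d cl).
pose B := @Substructure M (fun x => exists i, d' i = x) (clR d' cl').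
have fg (e : I -> M) (cle : closed_family e) :
    finitely_generated (@Substructure M (fun x => exists i, e i = x) (clR e cle)).
  exists (range e); split.
  - exact/finite_image/finite_finset.
  - by move=> _ [i _ <-]; exists i.
  - by move=> C HC _ [i <-]; apply: HC; exists i.
(* An index is chosen for every element of the range; the implication between equalities makes the
   choice irrelevant. Used in both directions, this gives a map and its inverse. *)
have lift_map (u v : I -> M) (clu : closed_family u) (clv : closed_family v) :
    (forall i j, u i = u j -> v i = v j) ->
    exists f : induced (@Substructure M _ (clR u clu)) ->
               induced (@Substructure M _ (clR v clv)),
      forall i x, u i = sval x -> sval (f x) = v i.
  move=> uv; exists (fun x => let i := sval (cid (svalP x)) in
    exist _ (v i) (ex_intro _ i erefl)) => i x /=.
  by case: cid => j /= <- /uv.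
have [f fE] := lift_map d d' cl cl' (fun i j => proj1 (deq i j)).
have [g gE] := lift_map d' d cl' cl (fun i j => proj2 (deq i j)).
rewrite -/A -/B in f fE g gE.
have valI (C : substructure M) (x y : induced C) : sval x = sval y -> x = y.
  by case: x y => [x px] [y py] /= E; apply: eq_exist.
have isof : isomorphism f.
  split; last first.
    exists g => x; apply: valI.
      case: (svalP x) => i xE; rewrite (gE i) //; by rewrite (fE i).
    case: (svalP x) => i xE; rewrite (fE i) //; by rewrite (gE i).
  split.
  - move=> x y /(congr1 sval).
    case: (svalP x) (svalP y) => i xE [j yE].
    by rewrite (fE i) // (fE j) // -deq xE yE => /valI.
  - move=> x y; case: (svalP x) (svalP y) => i xE [j yE] /=.
    rewrite (fE i) // (fE j) // -xE -yE !le_meet //.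
    exact: iff_sym (sim i j i).
  - move=> x y; apply: valI; case: (svalP x) (svalP y) => i xE [j yE].
    have [k Hk] := cl i j; rewrite (fE k) /=; last by rewrite -xE -yE.
    by rewrite (fE i) // (fE j) //; apply/esym/sim.
  - move=> x y; case: (svalP x) (svalP y) => i xE [j yE].
    by rewrite /= (fE i) // (fE j) // -xE -yE -dadj.
have [h [isoh hE]] := homM A B f (fg d cl) (fg d' cl') isof.
exists h; split=> // i.
have Hi : support A (d i) by exists i.
by rewrite (hE (exist _ (d i) Hi)) (fE i).
Qed.

(** The finite tree spanned by [e], with its graph replaced by [r], is again in [class_K] and so has
    a copy in [M]. Since [r] agrees with [adj] on the part [P], homogeneity moves that part of the
    copy back to its original place. *)
Lemma realize_graph (M : structure) n (e : 'I_n -> M) (P : pred 'I_n)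
    (r : M -> M -> Prop) :
  is_fraisse_limit class_K M -> closed_family e ->
  (forall i j, P i -> P j -> exists2 k, P k & meet (e i) (e j) = e k) ->
  (forall i j, r (e i) (e j) -> r (e j) (e i)) ->
  (forall i, ~ r (e i) (e i)) ->
  (forall i j, P i -> P j -> (r (e i) (e j) <-> adj (e i) (e j))) ->
  exists h : 'I_n -> M, [/\ similar e h,
    forall i j, adj (h i) (h j) <-> r (e i) (e j) &
    forall i, P i -> h i = e i].
Proof.
move=> HM cle clP rsym rirr rP.
have [tM gM] := fraisse_tree_graph HM; have [_ ageM _] := HM.
have cl x y : (exists i, e i = x) -> (exists i, e i = y) ->
    exists i, e i = meet x y.
  by move=> [i <-] [j <-]; have [k ->] := cle i j; exists k.
pose B := @Substructure M (fun x => exists i, e i = x) cl.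
pose S := {| carrier := induced B; le := @le (induced B);
  meet := @meet (induced B); adj := fun x y => r (sval x) (sval y) |}.
pose b i : S := exist _ (e i) (ex_intro _ i erefl).
have valI (x y : S) : sval x = sval y -> x = y.
  by case: x y => [x px] [y py] /= E; apply: eq_exist.
have KS : class_K S.
  split.
  - apply: (@sub_finite_set _ _ (range b)); last exact/finite_image/finite_finset.
    by move=> x _; case: (svalP x) => i Hi; exists i => //; apply: valI.
  - split.
    + by move=> x; apply: (lexx tM).
    + by move=> x y xy yx; apply: valI; apply: (le_anti tM).
    + by move=> x y z; apply: (le_trans tM).
    + by move=> x y z; apply: (le_total tM).
    + move=> x y; split; [exact: (le_meetl tM)|exact: (le_meetr tM)|].
      by move=> z; apply: (meet_glb tM).
  - split=> [x y|x]; case: (svalP x) => i /= <- //.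
    by case: (svalP y) => j /= <-; apply: rsym.
have /ageM[C [_ [f [[finj fle fmeet fadj] [g fK gK]]]]] := KS.
pose k (x : S) : M := sval (g x).
have kinj x y : k x = k y -> x = y.
  move=> E; rewrite -(gK x) -(gK y); congr f.
  move: E; rewrite /k; case: (g x) (g y) => [u pu] [v pv] /= E.
  exact: eq_exist.
have kmeet x y : k (meet x y) = meet (k x) (k y).
  rewrite /k -{1}(gK x) -{1}(gK y) -fmeet fK //.
have kadj x y : adj (k x) (k y) <-> adj x y.
  by rewrite -{2}(gK x) -{2}(gK y) fadj.
have simk : similar e (k \o b).
  move=> i j l; rewrite /= -kmeet; split=> [E|/kinj/(congr1 sval)//].
  by congr k; apply: valI.
pose J := {i : 'I_n | P i}.
have [||i j|h [[[_ _ hmeet hadj] [h' hK h'K]] hE]] :=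
    @homogeneity M J (k \o b \o sval) (e \o sval) HM.
- move=> i j; have [l Pl El] := clP _ _ (svalP i) (svalP j).
  by exists (exist _ l Pl) => /=; apply/(simk _ _ _).
- by move=> i j l; exact: (iff_sym (simk (sval i) (sval j) (sval l))).
- by rewrite /= kadj; apply: rP; [exact: (svalP i)|exact: (svalP j)].
exists (h \o k \o b); split.
- move=> i j l; rewrite (simk i j l) /= -hmeet; split=> [->//|].
  by move/(can_inj hK).
- by move=> i j; rewrite /= hadj kadj.
- by move=> i Pi; apply: (hE (exist _ i Pi)).
Qed.

(** * Positions of finitely many points over a finite tree *)

Lemma directed_max (K : nat) (P : nat -> Prop) (r : nat -> nat -> Prop) :
  (forall p q s, r p q -> r q s -> r p s) ->
  (exists2 p, p < K & P p) ->
  (forall p q, p < K -> q < K -> P p -> P q ->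
    exists s, [/\ s < K, P s, r p s & r q s]) ->
  exists s, [/\ s < K, P s & forall p, p < K -> P p -> r p s].
Proof.
move=> rtrans [p0 p0K Pp0] dir.
(* The bound on [p] is doubled so that the induction runs over one copy only, while all candidates
   stay below [K]. *)
suff [s [sK Ps Hs]] : exists s, [/\ s < K, P s &
    forall p, p < K -> p < K -> P p -> r p s].
  by exists s; split=> // p pK; apply: Hs.
elim: {2}K => [|j [s [sK Ps Hs]]]; first by exists p0; split.
have [[jK Pj]|nj] := pselect (j < K /\ P j).
  have [t [tK Pt st jt]] := dir _ _ sK jK Ps Pj.
  exists t; split=> // p; rewrite ltnS leq_eqVlt => /predU1P[->|pj] // pK Pp.
  exact: rtrans (Hs _ pj pK Pp) st.
exists s; split=> // p; rewrite ltnS leq_eqVlt => /predU1P[->|pj] pK Pp.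
  by case: nj.
exact: Hs.
Qed.

Section Positions.
Variables (M : structure) (treeM : is_meet_tree M).

(* The map [e p |-> e' p] for [p < K] is an isomorphism between finite
   subtrees; [partial_iso K e e] says that [e 0, ..., e K.-1] is meet-closed. *)
Definition partial_iso (K : nat) (e e' : nat -> M) : Prop :=
  (forall p q, p < K -> q < K -> exists r, [/\ r < K,
     meet (e p) (e q) = e r & meet (e' p) (e' q) = e' r]) /\
  (forall p q, p < K -> q < K -> (e p = e q <-> e' p = e' q)).

Lemma partial_iso_le K e e' p q : partial_iso K e e' -> p < K -> q < K ->
  le (e p) (e q) <-> le (e' p) (e' q).
Proof.
move=> [cl eqe] pK qK; rewrite !le_meet //.
by have [r [rK -> ->]] := cl p q pK qK; apply: eqe.
Qed.

Lemma partial_iso_meet K e e' p q r : partial_iso K e e' ->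
  p < K -> q < K -> r < K ->
  meet (e p) (e q) = e r <-> meet (e' p) (e' q) = e' r.
Proof.
move=> [cl eqe] pK qK rK; have [s [sK -> ->]] := cl p q pK qK; exact: eqe.
Qed.

Lemma partial_isoS K e e' : partial_iso K e e' ->
  (forall q, q < K ->
    (meet (e q) (e K) = e K /\ meet (e' q) (e' K) = e' K) \/
    exists r, [/\ r < K, meet (e q) (e K) = e r & meet (e' q) (e' K) = e' r]) ->
  (forall q, q < K -> (e q = e K <-> e' q = e' K)) ->
  partial_iso K.+1 e e'.
Proof.
move=> [cl eqe] clK eqK; split=> p q; rewrite !ltnS.
  have side s : s < K -> exists r, [/\ r <= K,
      meet (e s) (e K) = e r & meet (e' s) (e' K) = e' r].
    by move=> /clK[[H H']|[r [/ltnW rK H H']]]; [exists K|exists r]; split.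
  rewrite (leq_eqVlt p) (leq_eqVlt q) => /predU1P[->|pK] /predU1P[->|qK].
  - by exists K; split; rewrite ?meetxx // ltnS.
  - by rewrite (meetC treeM (e K)) (meetC treeM (e' K)); apply: side.
  - exact: side.
  - by have [r [/ltnW rK H H']] := cl p q pK qK; exists r; split.
rewrite (leq_eqVlt p) (leq_eqVlt q) => /predU1P[->|pK] /predU1P[->|qK] //.
- by split=> /esym/eqK-/(_ qK)/esym.
- exact: eqK.
- exact: eqe.
Qed.

(* [e K] is the largest meet of [e K.+1] with an element of the subtree
   [e 0, ..., e K.-1]; it either is [e p] (when [u.1.1]) or lies outside of the
   subtree with [e p] as least upper bound in it.  Finally [u.1.2] tells whether
   [e K.+1 = e K].  Hence there are only [O(K)] possible positions [u]. *)
Definition position (K : nat) (e : nat -> M) (u : bool * bool * nat) : Prop :=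
  [/\ u.2 < K,
      if u.1.1 then e K = e u.2
      else [/\ forall q, q < K -> e q <> e K, le (e K) (e u.2) &
               forall q, q < K -> le (e K) (e q) -> le (e u.2) (e q)],
      forall q, q < K -> meet (e q) (e K.+1) = meet (e q) (e K),
      le (e K) (e K.+1) &
      u.1.2 <-> e K.+1 = e K].

Lemma position_ext K e e' u : (forall p, p < K.+2 -> e' p = e p) ->
  position K e u -> position K e' u.
Proof.
move=> E [uK H1 H2 H3 H4].
have E' q : q < K -> e' q = e q by move=> qK; rewrite E // ltnW // ltnW.
split; rewrite ?(E K) ?(E K.+1) ?E' //; last by move=> q qK; rewrite E' ?H2.
by case: u.1.1 H1 => // -[h1 h2 h3]; split=> // q qK; rewrite E' //;
  [apply: h1|apply: h3].
Qed.

(** Both [y] and [meet a t] lie below [t], so they are comparable, which forces [meet a t] below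
    [y]. *)
Lemma meet_outside (a t y : M) : le y t -> ~ le t a -> ~ le y (meet a t) ->
  meet a y = meet a t.
Proof.
move=> yt nta nyat; have tM := treeM.
have aty : le (meet a t) y.
  by case: (le_total tM (le_meetr tM a t) yt).
apply: (le_anti tM); apply: (meet_glb tM); rewrite ?aty //; try exact: le_meetl.
exact: (le_trans tM) (le_meetr tM _ _) yt.
Qed.

(** The branch point [e K] is added first. Then [e K.+1] follows easily, since it has the same meets
    with the old points as [e K]. *)
Lemma partial_iso_position K e e' u :
  partial_iso K e e' -> position K e u -> position K e' u ->
  partial_iso K.+2 e e'.
Proof.
have tM := treeM; move=> iso [uK posc mx cx xc] [_ posc' mx' cx' xc'].
have isoc : partial_iso K.+1 e e'.
  have [cl eqe] := iso.
  apply: partial_isoS => //; case: u.1.1 posc posc' =>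
    [->->|[nc ct tmin] [nc' ct' tmin']] q qK.
  - by right; apply: cl.
  (* Above [e u.2] the meet with [e K] is [e K] itself; elsewhere it equals the meet with [e u.2],
     which is an old point [e r]. There [e K] is not below [e r], as minimality of [e u.2] would put
     [e u.2] below [e q]. *)
  - have [tq|ntq] := pselect (le (e u.2) (e q)).
      have tq' : le (e' u.2) (e' q) by apply/(partial_iso_le iso).
      by left; rewrite (meetC tM (e q)) (meetC tM (e' q)); split; apply/(le_meet tM);
        [apply: (le_trans tM) tq|apply: (le_trans tM) tq'].
    have ntq' : ~ le (e' u.2) (e' q) by move/(partial_iso_le iso uK qK).
    right; have [r [rK Er Er']] := cl q u.2 qK uK.
    exists r; split=> //; rewrite -?Er -?Er'; apply: meet_outside => //.
      rewrite Er => /tmin-/(_ rK); rewrite -Er => H; apply: ntq.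
      exact: (le_trans tM) H (le_meetl tM _ _).
    rewrite Er' => /tmin'-/(_ rK); rewrite -Er' => H; apply: ntq'.
    exact: (le_trans tM) H (le_meetl tM _ _).
  - exact: eqe.
  - by split=> [/nc|/nc'] /(_ qK).
have [cl eqe] := isoc.
have mxS (d : nat -> M) : (forall q, q < K -> meet (d q) (d K.+1) = meet (d q) (d K)) ->
    le (d K) (d K.+1) ->
    forall q, q < K.+1 -> meet (d q) (d K.+1) = meet (d q) (d K).
  move=> H /(le_meet tM) H' q; rewrite ltnS leq_eqVlt => /predU1P[->|/H//].
  by rewrite H' meetxx.
have eqxE (d : nat -> M) (w : bool) : (w <-> d K.+1 = d K) ->
    (forall q, q < K.+1 -> meet (d q) (d K.+1) = meet (d q) (d K)) ->
    le (d K) (d K.+1) ->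
    forall q, q < K.+1 -> d q = d K.+1 <-> w /\ d q = d K.
  move=> wE H /(le_meet tM) H' q qK; split=> [E|[/wE -> ->//]].
  suff xcE : d K.+1 = d K by rewrite E xcE; split=> //; apply/wE.
  by move: (H q qK); rewrite E meetxx // (meetC tM) H'.
apply: partial_isoS => // q qK.
  right; rewrite (mxS e) // (mxS e') //; exact: cl.
rewrite (eqxE e u.1.2) ?(eqxE e' u.1.2) //; [|exact: mxS|exact: mxS].
by split=> -[-> /(eqe q K qK (ltnSn K))].
Qed.

(** Every added element takes two places: its branch point at [K + i.*2], then the element
    itself. *)
Lemma partial_iso_positions K n e e' (u : nat -> bool * bool * nat) :
  partial_iso K e e' ->
  (forall i, i < n -> position (K + i.*2) e (u i)) ->
  (forall i, i < n -> position (K + i.*2) e' (u i)) ->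
  partial_iso (K + n.*2) e e'.
Proof.
move=> iso; elim: n => [|n IHn] pos pos'; first by rewrite addn0.
rewrite doubleS !addnS; apply: (partial_iso_position (u := u n)).
- by apply: IHn => i /ltnW ni; [apply: pos|apply: pos'].
- exact: pos.
- exact: pos'.
Qed.

Lemma position_exists K e (x : M) : 0 < K -> partial_iso K e e ->
  exists c u, position K (upd (upd e K c) K.+1 x) u.
Proof.
have tM := treeM; move=> K0 [cl _].
(* All meets with [x] lie below [x], so they form a chain and a largest one exists. *)
have [s [sK _ smax]] : exists s, [/\ s < K, True &
    forall p, p < K -> True -> le (meet (e p) x) (meet (e s) x)].
  apply: (directed_max (r := fun p s => le (meet (e p) x) (meet (e s) x))).
  - by move=> p q r; apply: (le_trans tM).
  - by exists 0.
  - move=> p q pK qK _ _; have lx := le_meetr tM.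
    case: (le_total tM (lx (e p) x) (lx (e q) x)) => H.
      by exists q; split=> //; apply: lexx.
    by exists p; split=> //; apply: lexx.
pose c := meet (e s) x; pose f := upd (upd e K c) K.+1 x.
have fE q : q < K -> f q = e q.
  by move=> qK; rewrite /f /upd !ltn_eqF // ltnW.
have fK : f K = c by rewrite /f /upd eqxx ltn_eqF.
have fK1 : f K.+1 = x by rewrite /f /upd eqxx.
have cx : le c x by apply: le_meetr.
have mx q : q < K -> meet (f q) x = meet (f q) c.
  move=> qK; rewrite fE //; apply: (le_anti tM); apply: (meet_glb tM).
  - exact: le_meetl.
  - exact: smax.
  - exact: le_meetl.
  - exact: (le_trans tM) (le_meetr tM _ _) cx.
have [[p pK cp]|ncp] := pselect (exists2 p, p < K & c = e p).
  exists c, (true, `[<x = c>], p); split; rewrite -/f ?fK ?fK1 ?fE //.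
  by split=> [/asboolP|H]; last exact/asboolP.
(* The points of the subtree above [c] are closed under meets, hence have a least element;
   [directed_max] is used for the reversed order. *)
have [t [tK ct tmin]] : exists t, [/\ t < K, le c (e t) &
    forall p, p < K -> le c (e p) -> le (e t) (e p)].
  apply: (directed_max (r := fun p t => le (e t) (e p))).
  - by move=> p q r qp rq; apply: (le_trans tM) rq qp.
  - by exists s => //; apply: le_meetl.
  - move=> p q pK qK cp cq; have [r [rK Er _]] := cl p q pK qK.
    exists r; rewrite -Er; split=> //; [exact: meet_glb|exact: le_meetl|].
    exact: le_meetr.
exists c, (false, `[<x = c>], t); split; rewrite -/f ?fK ?fK1 ?fE //.
  split=> // q qK; rewrite fE //; last exact: tmin.
  by move=> E; apply: ncp; exists q.
by split=> [/asboolP|H]; last exact/asboolP.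
Qed.

Lemma positions_exist K n e (x : nat -> M) : 0 < K -> partial_iso K e e ->
  exists (e' : nat -> M) (u : nat -> bool * bool * nat),
    [/\ forall p, p < K -> e' p = e p,
        forall i, i < n -> e' (K + i.*2).+1 = x i,
        forall i, i < n -> position (K + i.*2) e' (u i) &
        partial_iso (K + n.*2) e' e'].
Proof.
move=> K0 iso; elim: n => [|n [e' [u [eE ex pos iso']]]].
  by exists e, (fun=> (true, true, 0)); rewrite addn0; split.
have K'0 : 0 < K + n.*2 by rewrite addn_gt0 K0.
have [c [v posv]] := position_exists (x n) K'0 iso'.
pose f := upd (upd e' (K + n.*2) c) (K + n.*2).+1 (x n).
have fE p : p < K + n.*2 -> f p = e' p.
  by move=> pK; rewrite /f /upd !ltn_eqF // ltnW.
have lti i : i < n -> (K + i.*2).+1 < K + n.*2.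
  by rewrite -leq_double doubleS -(leq_add2l K) !addnS.
have posf i : i < n.+1 -> position (K + i.*2) f (if i == n then v else u i).
  rewrite ltnS leq_eqVlt; case: eqP => [->//|_ /= ni].
  apply: position_ext (pos _ ni) => p pK; apply: fE.
  exact: leq_trans pK (lti _ ni).
exists f, (fun i => if i == n then v else u i); split=> //.
- by move=> p pK; rewrite fE ?eE // (leq_trans pK) // leq_addr.
- move=> i; rewrite ltnS leq_eqVlt => /predU1P[->|ni].
    by rewrite /f /upd eqxx.
  by rewrite fE ?ex // lti.
apply: (partial_iso_positions _ posf posf).
have [cl eqe] := iso; split=> // p q pK qK.
have [r [rK E _]] := cl p q pK qK.
have fe s : s < K -> f s = e s.
  by move=> sK; rewrite fE ?eE // (leq_trans sK) // leq_addr.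
by exists r; rewrite !fe.
Qed.

End Positions.

(* [classical_sets] shadows many names of [fintype] and [finset]. *)
Import boot.fintype boot.finset.

(** * Pigeonhole principles *)

Lemma pigeonhole (T C : finType) (J : {set T}) (f : T -> C) q :
  #|C| * q < #|J| -> exists c, q < #|[set j in J | f j == c]|.
Proof.
move=> H; apply/existsP; apply: contraTT H => /existsPn H.
rewrite -leqNgt -sum1_card (partition_big f predT) //=.
rewrite -sum_nat_const; apply: leq_sum => c _; rewrite leqNgt.
by apply: contra (H c); rewrite -sum1dep_card.
Qed.

(** [F] is contained in the product of its projections. *)
Lemma large_projection (D T : finType) (F : {set {ffun D -> T}}) q :
  q ^ #|D| < #|F| -> exists i, q < #|[set f i | f : {ffun D -> T} in F]|.
Proof.
move=> H; apply/existsP; apply: contraTT H => /existsPn H; rewrite -leqNgt.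
pose S i := [set f i | f : {ffun D -> T} in F].
have FS : F \subset family S.
  by apply/subsetP => f fF; apply/familyP => i; apply: imset_f.
apply: leq_trans (subset_leq_card FS) _.
rewrite card_family foldrE big_map -sum1_card.
rewrite (big_morph (fun n => q ^ n) (expnD q) (expn0 q)) big_enum /=.
by apply: leq_prod => i _; rewrite expn1 leqNgt H.
Qed.

(* Think of [j] as carrying the partial function with values [v j (d j l)] at
   the points [d j l] for [l \in S]. Either many of them agree with a fixed
   one, or many of them share a point and their value there, in which case that
   point can be dropped from the domains. *)
Lemma compatible_subfamily (L Q : finType) (V : Type) s k :
  exists B, forall (I : finType) (J : {set I}) (d : I -> L -> V)
      (v : I -> V -> Q) (S : {set L}), B <= #|J| -> #|S| <= s ->
    exists J' : {set I}, [/\ J' \subset J, k <= #|J'| &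
      forall i j l l', i \in J' -> j \in J' -> l \in S -> l' \in S ->
        d i l = d j l' -> v i (d i l) = v j (d i l)].
Proof.
elim: s k => [|s IHs] k.
  exists k => I J d v S kJ; rewrite leqn0 cards_eq0 => /eqP->.
  by exists J; split=> // i j l l' _ _; rewrite inE.
elim: k => [|k [B1 HB1]].
  exists 0 => I J d v S _ _; exists set0; split=> [||i j l l'].
  - exact: sub0set.
  - by [].
  - by rewrite inE.
have [B2 HB2] := IHs k.+1.
(* One member is set aside as [j0]. Of the others, either [B1] agree with it, or more than
   [#|{: L * L * Q}| * B2] do not. *)
exists (B1 + (#|{: L * L * Q}| * B2).+1).+1 => I J d v S BJ Ss.
have /card_gt0P[j0 j0J] : 0 < #|J| by apply: leq_trans BJ.
pose agree j := `[< forall l l', l \in S -> l' \in S ->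
  d j0 l = d j l' -> v j0 (d j0 l) = v j (d j0 l) >].
pose J1 := [set j in J :\ j0 | agree j].
pose J2 := [set j in J :\ j0 | ~~ agree j].
have cJ : #|J1| + #|J2| = #|J :\ j0|.
  rewrite -(cardsID [set j | agree j] (J :\ j0)).
  by congr (_ + _); apply: eq_card => j; rewrite !inE // andbC.
have [B1J1|J1B1] := leqP B1 #|J1|.
  have [J' [J'J1 kJ' HJ']] := HB1 I J1 d v S B1J1 Ss.
  have j0J' : j0 \notin J'.
    by apply/negP => /(subsetP J'J1); rewrite !inE eqxx.
  exists (j0 |: J'); split.
  - rewrite subUset sub1set j0J; apply: subset_trans J'J1 _.
    by apply/subsetP => j; rewrite !inE -andbA => /and3P[].
  - by rewrite cardsU1 j0J'.
  - have agr j l l' : j \in J' -> l \in S -> l' \in S ->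
        d j0 l = d j l' -> v j0 (d j0 l) = v j (d j0 l).
      by move=> /(subsetP J'J1); rewrite inE => /andP[_ /asboolP]; apply.
    move=> i j l l' /setU1P[->|iJ'] /setU1P[->|jJ'] lS l'S E //.
    + exact: agr E.
    + by rewrite E; apply/esym/(agr i l' l).
    + exact: HJ' E.
have J2B : #|{: L * L * Q}| * B2 < #|J2|.
  move: BJ; rewrite (cardsD1 j0 J) j0J add1n ltnS -cJ => BJ.
  rewrite -(ltn_add2l B1) -addnS; apply: leq_trans BJ _.
  by rewrite leq_add2r ltnW.
have [p0] : inhabited (L * L * Q).
  have /card_gt0P[j] : 0 < #|J2| by apply: leq_trans J2B.
  rewrite inE => /andP[_ /asboolPn/existsNP[l /existsNP[l' _]]].
  by split; exact: (l, l', v j0 (d j0 l)).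
(* A member that disagrees with [j0] shares a point with it. It is colored by the two indices of
   that point and by its own value there; on one color class, [l'] can then be removed from [S]. *)
have /choice[f Hf] : forall j, exists x : L * L * Q, j \in J2 ->
    [/\ x.1.2 \in S, d j0 x.1.1 = d j x.1.2 & v j (d j x.1.2) = x.2].
  move=> j.
  case: (boolP (j \in J2)) => [|_]; last by exists p0.
  rewrite inE => /andP[_ /asboolPn/existsNP[l /existsNP[l']]].
  move=> /not_implyP[_ /not_implyP[l'S /not_implyP[E _]]].
  by exists (l, l', v j (d j l')).
have [[[l l'] c] HJ3] := pigeonhole f J2B.
set J3 := [set j in J2 | _] in HJ3.
have HJ3' j : j \in J3 -> [/\ l' \in S, d j l' = d j0 l & v j (d j0 l) = c].
  rewrite inE => /andP[jJ2 /eqP fj]; have := Hf j jJ2; rewrite fj /=.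
  by move=> [-> <- <-].
have l'S : l' \in S.
  by have /card_gt0P[j /HJ3'[]] : 0 < #|J3| by apply: leq_trans HJ3.
have S's : #|S :\ l'| <= s by move: Ss; rewrite (cardsD1 l' S) l'S.
have [J' [J'J3 kJ' HJ']] := HB2 I J3 d v (S :\ l') (ltnW HJ3) S's.
have J3J : J3 \subset J.
  by apply/subsetP => j; rewrite !inE => /andP[/andP[/andP[]]].
exists J'; split=> [||i j a b iJ' jJ' aS bS E].
- exact: subset_trans J'J3 J3J.
- exact: kJ'.
have [_ il vi] := HJ3' i (subsetP J'J3 i iJ').
have [_ jl vj] := HJ3' j (subsetP J'J3 j jJ').
have [al|al] := eqVneq a l'; first by rewrite al il vi vj.
have [bl|bl] := eqVneq b l'; first by rewrite E bl jl vi vj.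
by apply: (HJ' i j a b) => //; rewrite !inE ?al ?bl.
Qed.

(** * Common realizations *)

(** A meet of three elements is already a meet of two of them, because the meets of one element with
    the two others are comparable. *)
Lemma pair_meets_closed (M : structure) (G : Type) (c : G -> M) :
  is_meet_tree M -> closed_family (fun x : G * G => meet (c x.1) (c x.2)).
Proof.
move=> tM [u v] [s t] /=.
have add (x : G * G) (y : G) : exists z : G * G,
    meet (meet (c x.1) (c x.2)) (c y) = meet (c z.1) (c z.2).
  case: x => u0 v0 /=.
  have lel := le_meetl tM; have ler := le_meetr tM.
  case: (le_total tM (lel (c u0) (c v0)) (lel (c u0) (c y))) => H.
    exists (u0, v0) => /=; apply/(le_meet tM).
    exact: (le_trans tM) H (ler _ _).
  exists (u0, y) => /=; apply: (le_anti tM); apply: (meet_glb tM) => //.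
  exact: (le_trans tM) (lel _ _) (lel _ _).
have [z zE] := add (u, v) s; have [w wE] := add z t.
by exists w; rewrite -wE -zE /= (meetA tM).
Qed.

(* The trees [e i] over the common part [eA] are isomorphic, and their graph
   relations are glued along the sets of pairwise meets of the elements
   [e i (idx i g)]: only the graph on these sets has to be preserved. *)
Lemma common_realization (M : structure) (N n : nat) (I G : finType)
    (J : {set I}) (i0 : I) (eA : nat -> M) (e : I -> nat -> M)
    (idx : I -> G -> 'I_(N + n)) :
  is_fraisse_limit class_K M -> i0 \in J ->
  partial_iso N eA eA ->
  (forall i p, p < N -> e i p = eA p) ->
  (forall i j, i \in J -> j \in J -> partial_iso (N + n) (e i) (e j)) ->
  (forall i j p q, i \in J -> j \in J -> N <= p < N + n -> N <= q < N + n ->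
    adj (e i p) (e i q) <-> adj (e j p) (e j q)) ->
  (forall i j (x y : G * G) p, i \in J -> j \in J -> N <= p < N + n ->
    meet (e i (idx i x.1)) (e i (idx i x.2)) =
    meet (e j (idx j y.1)) (e j (idx j y.2)) ->
    adj (e i p) (meet (e i (idx i x.1)) (e i (idx i x.2))) <->
    adj (e j p) (meet (e i (idx i x.1)) (e i (idx i x.2)))) ->
  exists h : 'I_(N + n) -> M,
    (forall p : 'I_(N + n), p < N -> h p = eA p) /\
    forall i, i \in J -> exists s : M -> M,
      isomorphism s /\ forall g, s (e i (idx i g)) = h (idx i g).
Proof.
move=> HM i0J isoA eE iso newadj oldadj.
have [tM [adjC adjirr]] := fraisse_tree_graph HM.
set K := N + n in idx iso newadj oldadj *.
pose d i (x : G * G) := meet (e i (idx i x.1)) (e i (idx i x.2)).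
pose D i u := exists x, u = d i x.
(* The pairs on which the glued graph copies that of [e i]: both old, both new, or a new point with
   an old one among the pairwise meets of [i]. *)
pose free i (p q : nat) := [\/ p < N /\ q < N, N <= p /\ N <= q,
  [/\ N <= p, q < N & D i (e i q)] | [/\ p < N, N <= q & D i (e i p)]].
pose r (u v : M) := exists i (p q : 'I_K),
  [/\ i \in J, u = e i0 p, v = e i0 q, free i p q & adj (e i p) (e i q)].
have eqJ i j (p q : 'I_K) : i \in J -> j \in J -> e i p = e i q -> e j p = e j q.
  by move=> iJ jJ; have [_ eqe] := iso i j iJ jJ;
    case: (eqe p q (ltn_ord p) (ltn_ord q)).
pose e0 (p : 'I_K) := e i0 p.
have ltNK p : p < N -> p < K by move=> pN; apply: leq_trans pN (leq_addr _ _).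
have [||||p q /= pN qN|h [sim0 hadj hA]] :=
    @realize_graph M K e0 (fun p => p < N) r HM.
- move=> p q; have [cl _] := iso i0 i0 i0J i0J.
  have [s [sK E _]] := cl p q (ltn_ord p) (ltn_ord q).
  by exists (Ordinal sK).
- move=> p q pN qN; have [cl _] := isoA.
  have [s [sN E _]] := cl p q pN qN.
  by exists (Ordinal (ltNK s sN)); rewrite // /e0 !eE.
- move=> p q [i [p' [q' [iJ pE qE fr ad]]]].
  exists i, q', p'; split=> //; last exact: adjC.
  by case: fr => [[]|[]|[]|[]]; [constructor 1|constructor 2|constructor 4|constructor 3].
- move=> p [i [p' [q' [iJ pE qE _ ad]]]].
  apply: (adjirr (e i p')); rewrite {2}(eqJ i0 i p' q' i0J iJ) //.
  by rewrite -pE.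
- split=> [[i [p' [q' [iJ pE qE _ ad]]]]|ad].
    have pE' := eqJ i0 i _ _ i0J iJ pE; have qE' := eqJ i0 i _ _ i0J iJ qE.
    by rewrite /e0 !eE // -(eE i) // -(eE i q) // pE' qE'.
  by exists i0, p, q; split=> //; constructor 1.
exists h; split=> [p pN|i iJ]; first by rewrite hA // /e0 eE.
have simi : similar (fun p : 'I_K => e i p) h.
  move=> p q s; apply: iff_trans (sim0 p q s).
  exact: (partial_iso_meet (iso i i0 iJ i0J)).
have /choice[rho rhoE] : forall x, exists p : 'I_K, d i x = e i p.
  move=> x.
  have [cl _] := iso i i iJ iJ.
  have [s [sK E _]] := cl _ _ (ltn_ord (idx i x.1)) (ltn_ord (idx i x.2)).
  by exists (Ordinal sK).
have rhoE' x : meet (h (idx i x.1)) (h (idx i x.2)) = h (rho x).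
  exact: (proj1 (simi _ _ _) (rhoE x)).
have [|x y z|x y|s [isos sE]] := @homogeneity M (G * G)%type (d i) (h \o rho) HM.
- exact: (pair_meets_closed (fun g => e i (idx i g)) tM).
- by rewrite !rhoE; apply: (simi (rho x) (rho y) (rho z)).
- rewrite !rhoE /= hadj; split=> [ad|].
    exists i, (rho x), (rho y); split=> //.
    have Dx : D i (e i (rho x)) by exists x.
    have Dy : D i (e i (rho y)) by exists y.
    case: (ltnP (rho x) N) => Hx; case: (ltnP (rho y) N) => Hy.
    + by constructor 1.
    + by constructor 4.
    + by constructor 3.
    + by constructor 2.
  move=> [j [p [q [jJ pE qE fr]]]].
  have pE' := eqJ i0 i _ _ i0J iJ pE; have qE' := eqJ i0 i _ _ i0J iJ qE.
  rewrite pE' qE'.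
  (* An edge between a new and an old point may come from another [j]. Its old point is then a
     pairwise meet for both [i] and [j], where [oldadj] makes the two graphs agree. *)
  have half (p' q' : 'I_K) y' : N <= p' -> q' < N -> D j (e j q') ->
      d i y' = e i q' -> adj (e j p') (e j q') -> adj (e i p') (e i q').
    move=> Np' qN [w wE] y'E; have E : d i y' = d j w by rewrite y'E -wE !eE.
    have := oldadj i j y' w p' iJ jJ; rewrite Np' ltn_ord -/(d i y') -/(d j w) => H.
    by rewrite -y'E (H isT E) E -wE.
  case: fr => [[pN qN]|[Np Nq]|[Np qN Dq]|[pN Nq Dp]].
  + by rewrite !eE.
  + by apply: (proj1 (newadj j i p q jJ iJ _ _)); rewrite ?Np ?Nq ltn_ord.
  + by apply: (half _ _ y) => //; rewrite rhoE qE'.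
  + by move=> /adjC ad; apply: adjC; apply: (half _ _ x) => //; rewrite rhoE pE'.
(* The diagonal pair gives back the element, as meets are idempotent. *)
exists s; split=> // g; have := sE (g, g).
rewrite /d /= -(rhoE' (g, g)) /= !meetxx //.
Qed.

(** * The finite bound on inp-patterns *)

Lemma fraisse_inhabited (M : structure) :
  is_fraisse_limit class_K M -> inhabited M.
Proof.
move=> [_ ageM _].
pose U := {| carrier := unit; le := fun _ _ => True; meet := fun _ _ => tt;
             adj := fun _ _ => False |}.
have /ageM[B [_ [f [_ [g _ _]]]]] : class_K U.
  split; first exact: finite_finset.
    by split=> /=; [|move=> [] []| |left|split].
  by split=> [a b []|a []].
by split; exact: (sval (g tt)).
Qed.

(* [1 + (n.+1 * L * m).*2] points suffice for the tree generated by the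
   parameters, and each of the [n] variables then has at most
   [4 * (1 + (n.+1 * L * m).*2 + n.*2).+1] positions. *)
Lemma paths_outnumber_positions n m q :
  exists L, (4 * ((1 + (n.+1 * L * m).*2) + n.*2).+1) ^ n * q < L ^ n.+1.
Proof.
pose c := 4 * (2 * (n.+1 * m) + n.*2 + 2).
have key l : 0 < l -> 4 * ((1 + (n.+1 * l * m).*2) + n.*2).+1 <= c * l.
  move=> l0; rewrite mulnAC /c; have := leq_pmulr n.*2 l0.
  by move: (n.+1 * m) => y; nia.
(* With at most [c * L] positions per variable, [(c * L) ^ n * q = c ^ n * q * L ^ n], which is less
   than [L * L ^ n]. *)
pose L := (c ^ n * q).+1; exists L.
apply: (@leq_ltn_trans ((c * L) ^ n * q)).
  rewrite leq_mul2r; apply/orP; right.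
  by case: (posnP n) => [->|n0]; rewrite ?expn0 // leq_exp2r //; apply: key.
by rewrite expnMn mulnAC (mulnC _ (L ^ n)) expnSr ltn_pmul2l // expn_gt0.
Qed.

(** The finitary core of the argument. Of formulas it keeps only the invariance under isomorphisms,
    and [L] depends neither on [Phi] nor on [a]. *)
Lemma inp_pattern_bound (M : structure) n m k :
  is_fraisse_limit class_K M ->
  exists L, forall (Phi : 'I_n.+1 -> ('I_n -> M) -> ('I_m -> M) -> Prop)
      (a : 'I_n.+1 -> 'I_L -> 'I_m -> M),
    (forall i s b c, isomorphism s -> Phi i b c -> Phi i (s \o b) (s \o c)) ->
    (forall f : {ffun 'I_n.+1 -> 'I_L}, exists b, forall i, Phi i b (a i (f i))) ->
    exists i (J : {set 'I_L}), k <= #|J| /\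
      exists b, forall j, j \in J -> Phi i b (a i j).
Proof.
move=> HM; have [x0] := fraisse_inhabited HM.
have [tM _] := fraisse_tree_graph HM.
pose G : finType := ('I_m + 'I_n)%type.
pose Q : finType := {ffun 'I_(n.*2) -> bool}.
(* The points to reconcile are the pairwise meets of the [m] parameters of a column and the [n]
   variables. Asking for [k.+1] columns keeps [J] nonempty even when [k = 0]. *)
have [B HB] := compatible_subfamily (G * G)%type Q M #|{: G * G}| k.+1.
pose C : finType := {ffun 'I_(n.*2) * 'I_(n.*2) -> bool}.
pose q := (#|C| * B) ^ n.+1.
have [L HL] := paths_outnumber_positions n m q.
exists L => Phi a PhiI paths.
pose T : finType := ('I_n.+1 * 'I_L * 'I_m)%type.
pose x (p : nat) := if insub p is Some o then
  let t : T := enum_val (o : 'I_#|T|) in a t.1.1 t.1.2 t.2 else x0.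
have iso1 : partial_iso 1 (fun=> x0) (fun=> x0).
  by split=> // -[] // [] // _ _; exists 0; rewrite meetxx.
have [eA [_ [_ eAx _ isoA]]] := positions_exist tM #|T| x (ltn0Sn 0) iso1.
have cardT : #|T| = n.+1 * L * m by rewrite !card_prod !card_ord.
rewrite cardT in eAx isoA; set N := 1 + _ in eAx isoA HL.
have N0 : 0 < N by [].
(* The tree starts with the single point [x0], and each parameter comes right after its branch
   point. *)
pose apos i j l := (1 + (enum_rank ((i, j, l) : T)).*2).+1.
have aposN i j l : apos i j l < N.
  by rewrite /apos /N -cardT !add1n !ltnS -doubleS leq_double.
have aposE i j l : eA (apos i j l) = a i j l.
  rewrite eAx /x; last by rewrite -cardT.
  by rewrite valK /= enum_rankK.
have /choice[w Hw] : forall f : {ffun 'I_n.+1 -> 'I_L},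
    exists w : ('I_n -> M) * (nat -> M) * (nat -> bool * bool * nat),
    [/\ forall i, Phi i w.1.1 (a i (f i)),
        forall p, p < N -> w.1.2 p = eA p,
        forall l : 'I_n, w.1.2 (N + l.*2).+1 = w.1.1 l &
        forall i, i < n -> position (N + i.*2) w.1.2 (w.2 i)].
  move=> f; have [b Hb] := paths f.
  pose y (p : nat) := if insub p is Some l then b l else x0.
  have [e [u [H1 H2 H3 H4]]] := positions_exist tM n y N0 isoA.
  by exists (b, e, u); split=> //= l; rewrite H2 // /y valK.
pose e f := (w f).1.2.
pose b f := (w f).1.1.
(* A finite code of the positions; [inord] loses nothing, since the index in each position is below
   [N + n.*2]. *)
pose code f := [ffun l : 'I_n =>
  (((w f).2 l).1, inord ((w f).2 l).2 : 'I_(N + n.*2).+1)].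
have posf f i : i < n -> position (N + i.*2) (e f) ((w f).2 i).
  by case: (Hw f) => _ _ _; apply.
have isoe f f' : code f = code f' -> partial_iso (N + n.*2) (e f) (e f').
  move=> cf; apply: (partial_iso_positions tM (u := (w f).2)).
  - by case: (Hw f) (Hw f') => [_ E _ _] [_ E' _ _]; case: isoA => cl eqA;
      split=> [p r pN rN|p r pN rN]; rewrite /e !E // !E' //;
      have [s [sN Es _]] := cl p r pN rN; exists s; rewrite E ?E'.
  - exact: posf.
  move=> i ni; suff -> : (w f).2 i = (w f').2 i by apply: posf.
  have := congr1 (fun g : {ffun _} => g (Ordinal ni)) cf; rewrite !ffunE /=.
  have lt2 f0 : ((w f0).2 i).2 < (N + n.*2).+1.
    have [H _ _ _ _] := posf f0 i ni; apply: leq_trans H _.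
    by rewrite leqW // leq_add2l leq_double ltnW.
  case=> E1 /(congr1 val); rewrite /= !inordK // => E2.
  by rewrite [LHS]surjective_pairing [RHS]surjective_pairing E1 E2.
have [c Hc] : exists c, q < #|[set f in setT | code f == c]|.
  apply: pigeonhole; rewrite cardsT !card_ffun !card_ord !card_prod card_bool.
  by rewrite card_ord.
set F := [set f in _ | _] in Hc.
have codeF f f' : f \in F -> f' \in F -> code f = code f'.
  by rewrite !inE => /eqP-> /eqP->.
have [i Hi] : exists i, #|C| * B < #|[set f i | f : {ffun _} in F]|.
  by apply: large_projection; rewrite card_ord.
(* Each column [j] used by [F] in row [i] is represented by one path through it; the other columns
   get a dummy path. *)
have /choice[g Hg] : forall j : 'I_L, exists f : {ffun 'I_n.+1 -> 'I_L},
    j \in [set f i | f : {ffun 'I_n.+1 -> 'I_L} in F] -> f \in F /\ f i = j.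
  move=> j; case: (boolP (j \in _)) => [/imsetP[f fF ->]|_]; first by exists f.
  by exists [ffun=> j].
set J0 := [set f i | f : {ffun _} in F] in Hi Hg.
pose color j : C := [ffun x : 'I_(n.*2) * 'I_(n.*2) =>
  `[< adj (e (g j) (N + x.1)) (e (g j) (N + x.2)) >]].
have [c1 /ltnW Hc1] := pigeonhole color Hi.
set J1 := [set j in J0 | _] in Hc1.
have bpos (l : 'I_n) : (N + l.*2).+1 < N + n.*2.
  by rewrite -addnS ltn_add2l -doubleS leq_double.
have aposNn i0 j l : apos i0 j l < N + n.*2 by apply: leq_trans (leq_addr _ _).
pose idx j (s : G) : 'I_(N + n.*2) := match s with
  | inl l => Ordinal (aposNn i j l) | inr l => Ordinal (bpos l) end.
pose d j (s : G * G) := meet (e (g j) (idx j s.1)) (e (g j) (idx j s.2)).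
pose v j u : Q := [ffun p : 'I_(n.*2) => `[< adj (e (g j) (N + p)) u >]].
have [J [JJ1 kJ HJ]] := HB _ J1 d v setT Hc1 (max_card _).
have /card_gt0P[j0 j0J] : 0 < #|J| by apply: leq_trans kJ.
have JF j : j \in J -> g j \in F /\ g j i = j.
  by move/(subsetP JJ1); rewrite inE => /andP[/Hg].
have offset p : N <= p < N + n.*2 -> exists r : 'I_(n.*2), p = N + r.
  move=> /andP[Np pn]; have rn : p - N < n.*2 by rewrite ltn_subLR.
  by exists (Ordinal rn); rewrite /= subnKC.
have [j p pN|j j' jJ j'J|j j' p r jJ j'J|j j' s t p jJ j'J|h [hA hJ]] :=
    @common_realization M N n.*2 _ G J j0 eA (fun j => e (g j)) idx HM j0J isoA.
- by case: (Hw (g j)) => _ E _ _; apply: E.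
- by apply: isoe; apply: codeF; [case: (JF j jJ)|case: (JF j' j'J)].
- move=> /offset[p' ->] /offset[r' ->].
  have colorE i' : i' \in J -> color i' = c1.
    by move/(subsetP JJ1); rewrite inE => /andP[_ /eqP].
  have /(congr1 (fun f : C => f (p', r'))) : color j = color j'.
    by rewrite !colorE.
  rewrite !ffunE /= => H.
  by split=> /asboolP A; apply/asboolP; [rewrite -H|rewrite H].
- move=> /offset[p' ->] E.
  have := HJ j j' s t jJ j'J (in_setT s) (in_setT t) E.
  move/(congr1 (fun f : Q => f p')); rewrite !ffunE => H.
  by split=> /asboolP A; apply/asboolP; [rewrite -H|rewrite H].
exists i, J; split; first exact: ltnW.
exists (fun l => h (Ordinal (bpos l))) => j jJ.
have [s [isos sE]] := hJ j jJ; have [PhiP eE bE _] := Hw (g j).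
have := PhiI i s _ _ isos (PhiP i).
have -> : s \o (w (g j)).1.1 = fun l => h (Ordinal (bpos l)).
  by apply: funext => l; rewrite /= -bE; apply: (sE (inr l)).
have [_ ->] := JF j jJ.
(* The parameters lie in the old part of the tree, where [h] agrees with [eA]. *)
suff -> : s \o a i j = a i j by [].
apply: funext => l; rewrite /= -{1}aposE -(eE _ (aposN _ _ _)).
by rewrite (sE (inl l)) hA ?aposE //; apply: aposN.
Qed.

(** * Transfer of patterns *)

Lemma splice_cat (T : Type) n m (b e : nat -> T) (c : m.-tuple T)
    (pos : nat -> nat) :
  (forall p : 'I_m, e (n + pos p) = tnth c p) ->
  vec (n + m) (splice n b e \o (fun p => if p < n then p else n + pos (p - n)))
  = cat_tuple (vec n b) c.
Proof.
move=> H; apply: eq_from_tnth => i; rewrite tnth_mktuple /=.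
case: (split_ordP i) => l ->.
  by rewrite tnth_lshift tnth_mktuple /= /splice !ltn_ord.
have ltnn x : (n + x < n) = false by rewrite ltnNge leq_addr.
by rewrite tnth_rshift /splice /= !ltnn addKn H.
Qed.

Lemma models_inhabited (M N : structure) :
  inhabited M -> models N (theory_of M) -> inhabited N.
Proof.
move=> [x] /(_ (FImp (FAll (FFalse 1)) (FFalse 0))) NM; apply: contrapT => nN.
by apply: NM => [/(_ x)//|y]; apply: nN.
Qed.

Lemma no_inp_pattern (M N : structure) n (m : 'I_n.+1 -> nat)
    (phi : forall i, formula (n + m i)) (a : forall i, nat -> (m i).-tuple N)
    (k : 'I_n.+1 -> nat) :
  is_fraisse_limit class_K M -> models N (theory_of M) ->
  (forall i, k_inconsistent (k i) (fun j => Instance (phi i) (a i j))) ->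
  ~ forall f : 'I_n.+1 -> nat, consistent
      (fun q => exists i, q = Instance (phi i) (a i (f i))).
Proof.
move=> HM NM incons cons.
have inhM := fraisse_inhabited HM; have [x0] := models_inhabited inhM NM.
have [y0] := inhM.
(* All parameters of the pattern share one environment: the first [n] places are kept for the
   variables, and [pickle] separates the rest. *)
pose code (i : 'I_n.+1) (j l : nat) := pickle (i, j, l).
pose r i j p := if p < n then p else n + code i j (p - n).
pose Psi i j (S : structure) (e : nat -> S) :=
  sat (phi i) (vec (n + m i) (e \o r i j)).
have dPsi i j : definable (Psi i j) by apply: definable_sat.
pose path (f : 'I_n.+1 -> nat) (S : structure) (e : nat -> S) :=
  exists b, forall i, Psi i (f i) S (splice n b e).
have dpath f : definable (path f).
  apply: (definable_exs (P := fun S e => forall i, Psi i (f i) S e)).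
  exact: definable_forall_fin.
pose e p := if unpickle (p - n) is Some (i, j, l)
            then nth x0 (a i j) l else x0.
have eE i j (l : 'I_(m i)) : e (n + code i j l) = tnth (a i j) l.
  by rewrite /e addKn pickleK (tnth_nth x0).
have pathN f : path f N e.
  have [N' [g [eg [b Hb]]]] := cons f.
  (* A path has finitely many rows, so its consistency is first-order and descends from the
     elementary extension to [N]. *)
  apply/(elementary_definable e eg (dpath f)); exists (nth (g x0) b) => i.
  rewrite /Psi (@splice_cat _ _ _ _ _ (map_tuple g (a i (f i))) (code i _)).
    by rewrite vec_nth; apply: (Hb _ (ex_intro _ i erefl)).
  by move=> p; rewrite tnth_map -eE.
pose m0 := \max_i m i; pose k0 := \max_i k i.
have [L HL] := inp_pattern_bound n m0 k0 HM.
pose fin (S : structure) (e : nat -> S) :=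
  (forall (i : 'I_n.+1) (J : {set 'I_L}), #|J| = k i -> ~ exists b,
     forall j : 'I_L, j \in J -> Psi i j S (splice n b e)) /\
  (forall f : {ffun 'I_n.+1 -> 'I_L}, path (fun i => f i) S e).
have dfin : definable fin.
  apply: definable_and; last exact: definable_forall_fin.
  apply: definable_forall_fin => i; apply: definable_forall_fin => J.
  apply: definable_guard; apply: definable_not.
  apply: (definable_exs
    (P := fun S e => forall j : 'I_L, j \in J -> Psi i j S e)).
  by apply: definable_forall_fin => j; apply: definable_guard.
have finN : fin N e.
  split=> [i J cJ [b Hb]|f]; last exact: pathN.
  apply: (incons i (map val (enum J))).
  - by rewrite map_inj_uniq ?enum_uniq //; apply: val_inj.
  - by rewrite size_map -cardE.
  exists N, id; split; first exact: elementary_id.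
  exists (vec n b) => _ [j /mapP[j' j'J ->] <-] /=.
  rewrite mem_enum in j'J; have := Hb j' j'J.
  rewrite /Psi (@splice_cat _ _ _ _ _ (map_tuple id (a i j')) (code i _)) //.
  by move=> p; rewrite tnth_map eE.
have [d [inconsM pathM]] := transfer inhM NM dfin (ex_intro _ e finN).
have mi i : m i <= m0 by apply: leq_bigmax.
(* Rows may have different numbers of parameters: they are padded to the maximum [m0] and cut back
   here. *)
pose restr i (c : 'I_m0 -> M) := [tuple c (widen_ord (mi i) l) | l < m i].
pose Phi i (b : 'I_n -> M) (c : 'I_m0 -> M) :=
  sat (phi i) (cat_tuple (mktuple b) (restr i c)).
pose a' (i : 'I_n.+1) (j : 'I_L) (l : 'I_m0) := d (n + code i j l).
have PhiE i j b (b' : nat -> M) : vec n b' = mktuple b ->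
    Phi i b (a' i j) <-> Psi i j M (splice n b' d).
  move=> bE; rewrite /Phi /Psi -bE.
  rewrite (@splice_cat _ _ _ _ _ (restr i (a' i j)) (code i _)) //.
  by move=> p; rewrite tnth_mktuple.
have ext (b : 'I_n -> M) : exists b', vec n b' = mktuple b.
  by exists (nth y0 (mktuple b)); rewrite vec_nth.
have [i s b c isos|f|i [J [kJ [b Hb]]]] := HL Phi a'.
- move/(sat_isomorphism (phi i) isos); rewrite /Phi.
  suff -> : map_tuple s (cat_tuple (mktuple b) (restr i c))
      = cat_tuple (mktuple (s \o b)) (restr i (s \o c)) by [].
  by apply: val_inj; rewrite /= map_cat -!map_comp.
- have [b' Hb'] := pathM f; exists (fun l => b' l) => i.
  exact/(PhiE i (f i) _ b' erefl).
(* Inconsistency concerns sets of exactly [k i] columns, so [J] is cut down to that size. *)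
have /card_geqP[s [us ss sJ]] : k i <= #|J|.
  by apply: leq_trans kJ; apply: leq_bigmax.
have [b' bE] := ext b; apply: (inconsM i [set j in s]).
  by rewrite cardsE -ss; apply/card_uniqP.
by exists b' => j; rewrite inE => /sJ/Hb/(PhiE i j b b' bE).
Qed.

Lemma consistent_sub (N : structure) n (p q : set (instance N n)) :
  (forall x, p x -> q x) -> consistent q -> consistent p.
Proof.
move=> pq [N' [g [eg [b Hb]]]]; exists N', g; split=> //.
by exists b => x /pq; apply: Hb.
Qed.

Theorem corollary4p21 (M : structure) (hM : is_fraisse_limit class_K M) :
  NTP2 (theory_of M) /\ inp_minimal (theory_of M).
Proof.
split=> [n m phi [N [NM [a [k [cons incons]]]]]|
  [N [NM [m [phi [a [k [incons cons]]]]]]]].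
  (* The first [n.+1] rows of a TP2 array already form a forbidden pattern; [inord] extends a path
     through them to all rows. *)
  apply: (@no_inp_pattern M N n (fun=> m) (fun=> phi)
    (fun i => a i) (fun=> k)) => //.
  move=> f; apply: consistent_sub (cons (fun p => f (inord p))).
  by move=> _ [i ->]; exists i; rewrite ?inord_val.
apply: (@no_inp_pattern M N 1 m phi a k hM NM incons) => f.
by apply: consistent_sub (cons f) => _ [i ->]; exists i.
Qed.
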